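(* Let $a<b$ be real numbers, let $0\le\alpha<1$, $\beta>0$, let $w\in C^1([a,b])$ with $w>0$ and $w'>0$, and let $f\in H^1(a,b)$. Then the left- and right-weighted generalized fractional derivatives of order $\alpha$ of $f$ (in the Riemann--Liouville sense) can be written, respectively, as $$ {}^{R}_{a,w}D^{\alpha,\beta}f(x)=\frac{1}{\phi(\alpha)}\sum_{j=0}^{\infty}(-\mu_\alpha)^j\;{}^{RL}_{a,w}I^{\beta j}f(x) $$ and $$ {}^{R}D^{\alpha,\beta}_{b,w}f(x)=\frac{-1}{\phi(\alpha)}\sum_{j=0}^{\infty}(-\mu_\alpha)^j\;{}^{RL}I^{\beta j}_{b,w}f(x). $$
   Context: $B$ is a normalization function with $B(0)=B(1)=1$ and $B(\alpha)\neq 0$. Put $\phi(\alpha)=\frac{1-\alpha}{B(\alpha)}$ and $\mu_\alpha=\frac{\alpha}{1-\alpha}$ (with $(-\mu_\alpha)^0=1$). The Mittag--Leffler function is $E_\beta(z)=\sum_{j=0}^\infty \frac{z^j}{\Gamma(\beta j+1)}$, $z\in\mathbb{C}$. The left- and right-weighted generalized fractional derivatives are $$ {}^{R}_{a,w}D^{\alpha,\beta}f(x)=\frac{1}{\phi(\alpha)}\frac{1}{w(x)}\frac{d}{dx}\int_a^x w(s)f(s)\,E_\beta\!\left[-\mu_\alpha(x-s)^\beta\right]ds, $$ $$ {}^{R}D^{\alpha,\beta}_{b,w}f(x)=\frac{-1}{\phi(\alpha)}\frac{1}{w(x)}\frac{d}{dx}\int_x^b w(s)f(s)\,E_\beta\!\left[-\mu_\alpha(s-x)^\beta\right]ds.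 $$ For $\gamma>0$, the left and right weighted Riemann--Liouville fractional integrals of order $\gamma$ are $$ {}^{RL}_{a,w}I^{\gamma}f(x)=\frac{1}{\Gamma(\gamma)}\frac{1}{w(x)}\int_a^x (x-s)^{\gamma-1}w(s)f(s)\,ds\quad (x>a), $$ $$ {}^{RL}I^{\gamma}_{b,w}f(x)=\frac{1}{\Gamma(\gamma)}\frac{1}{w(x)}\int_x^b (s-x)^{\gamma-1}w(s)f(s)\,ds\quad (x<b), $$ and by convention ${}^{RL}_{a,w}I^{0}f={}^{RL}I^{0}_{b,w}f=f$.
   Formalization: The right-sided formula is proved with factor 1/φ(α) instead of −1/φ(α): as printed it is false, since for α=0 the right derivative equals f while the printed right side is −f. Both identities are stated for a<x<b and the continuous representative of f. *)

(* Defs.v *)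
(* MathComp-Analysis world: the reals are an arbitrary [R : realType]. *)
From mathcomp Require Import all_boot all_order all_algebra.
From mathcomp Require Import all_classical all_reals all_analysis.

Set Implicit Arguments.
Unset Strict Implicit.
Unset Printing Implicit Defensive.

Import Order.TTheory GRing.Theory Num.Theory.
Import numFieldNormedType.Exports.

Local Open Scope classical_set_scope.
Local Open Scope ring_scope.

Definition Gamma (R : realType) (z : R) : R :=
  \int[lebesgue_measure]_(t in `]0, +oo[) (t `^ (z - 1) * expR (- t)).

(* Only real arguments of the entire function [E_beta] are ever needed. *)
Definition mittag_leffler (R : realType) (beta z : R) : R :=
  limn (series (fun j => z ^+ j / Gamma (beta * j%:R + 1))).

(* [dw] is the derivative of [w] on the closed interval, which is one-sided at
   the endpoints: the difference quotient is taken along [y != x] in [[a, b]].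
   Nothing is assumed of [w] outside [[a, b]]. *)
Definition C1_with_derivative (R : realType) (a b : R) (w dw : R -> R) : Prop :=
  {within `[a, b], continuous dw} /\
  (forall x, a <= x <= b ->
     (fun y => (w y - w x) / (y - x)) @ within `[a, b] x^' --> dw x).

Definition test_function (R : realType) (a b : R) (psi : R -> R) : Prop :=
  (forall n x, derivable (derive1n n psi) x 1) /\
  (exists c d, [/\ a < c, d < b & forall x, ~~ (c <= x <= d) -> psi x = 0]).

Definition L2 (R : realType) (a b : R) (f : R -> R) : Prop :=
  f \_ `]a, b[ \in Lfun lebesgue_measure 2%:E.

Definition weak_derivative (R : realType) (a b : R) (f g : R -> R) : Prop :=
  forall psi, test_function a b psi ->
    \int[lebesgue_measure]_(x in `]a, b[) (f x * psi^`()%classic x) =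
    - \int[lebesgue_measure]_(x in `]a, b[) (g x * psi x).

(* An element of [H^1(a, b)] is a class of functions modulo equality a.e.;
   since its pointwise values matter here, it is given by its unique
   representative that is continuous on [[a, b]]. *)
Definition H1 (R : realType) (a b : R) (f : R -> R) : Prop :=
  [/\ L2 a b f, exists g, L2 a b g /\ weak_derivative a b f g
    & {within `[a, b], continuous f}].

Section WeightedOperators.
Context {R : realType}.
Implicit Types (B w f : R -> R) (alpha beta gamma a b x : R).

Definition phi B alpha : R := (1 - alpha) / B alpha.

Definition mu alpha : R := alpha / (1 - alpha).

Definition left_primitive alpha beta a w f x : R :=
  \int[lebesgue_measure]_(s in `[a, x])
    (w s * f s * mittag_leffler beta (- mu alpha * (x - s) `^ beta)).

Definition right_primitive alpha beta b w f x : R :=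
  \int[lebesgue_measure]_(s in `[x, b])
    (w s * f s * mittag_leffler beta (- mu alpha * (s - x) `^ beta)).

(* [^`()] is total, so a statement about these derivatives has to assert the
   derivability of the primitive separately.  The leading minus sign of the right
   derivative cancels the one coming from differentiating in a lower bound. *)
Definition left_derivative B alpha beta a w f x : R :=
  (phi B alpha)^-1 * (w x)^-1 * (left_primitive alpha beta a w f)^`()%classic x.

Definition right_derivative B alpha beta b w f x : R :=
  - (phi B alpha)^-1 * (w x)^-1 * (right_primitive alpha beta b w f)^`()%classic x.

Definition left_RL_integral gamma a w f x : R :=
  if gamma == 0 then f x else
  (Gamma gamma)^-1 * (w x)^-1 *
    \int[lebesgue_measure]_(s in `[a, x]) ((x - s) `^ (gamma - 1) * w s * f s).

Definition right_RL_integral gamma b w f x : R :=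
  if gamma == 0 then f x else
  (Gamma gamma)^-1 * (w x)^-1 *
    \int[lebesgue_measure]_(s in `[x, b]) ((s - x) `^ (gamma - 1) * w s * f s).

Definition left_term alpha beta a w f x (j : nat) : R :=
  (- mu alpha) ^+ j * left_RL_integral (beta * j%:R) a w f x.

Definition right_term alpha beta b w f x (j : nat) : R :=
  (- mu alpha) ^+ j * right_RL_integral (beta * j%:R) b w f x.

End WeightedOperators.

(* Main.v *)
Require Import Defs.
From mathcomp Require Import all_boot all_order all_algebra.
From mathcomp Require Import all_classical all_reals all_analysis.
From mathcomp Require Import measurable_realfun.
From mathcomp Require Import ring lra.
Import Order.TTheory GRing.Theory Num.Theory.
Import numFieldNormedType.Exports.
Local Open Scope classical_set_scope.
Local Open Scope ring_scope.

(** Write [g = w * f], which is continuous on [[a, b]], and let [m] be minus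
[mu alpha]. Expanding the Mittag-Leffler function, the primitive to be
differentiated is the integral over [[a, x]] of [g s] times the sum over [j] of
[m ^+ j * (x - s) `^ (beta * j) / Gamma (beta * j + 1)]. Formally, the derivative
of the [j]-th term in [x] is [m ^+ j] times [w x] times the weighted
Riemann-Liouville integral of order [beta * j], because
[Gamma (z + 1) = z * Gamma z]; the term [j = 0] contributes [g x]. Dividing by
[w x] gives the series of the statement.

When [beta * j < 1] the derivative of the kernel is singular on the diagonal, so
the formal computation is run backwards: the candidate derivative is shown to be
a continuous function of which the given convolution is a primitive.
- For a single power this is Fubini's theorem on a triangle
  ([scaled_RL_primitive]), together with the continuity of fractional integrals
  of continuous functions ([scaled_RL_continuous]).
- For the whole series, Gamma outgrows every geometric sequence
  ([Gamma_lower_bound]), so that the terms have a summable majorant: the sum is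
  continuous by the Weierstrass test ([continuous_series]) and can be exchanged
  with the integrals by dominated convergence ([integral_series_cvg]).
The fundamental theorem of calculus then gives the derivative
([expansion_derivative]). These arguments are carried out for a bounded
continuous function on the line, which clamping the variable to [[a, b]] provides.

The right-sided formula follows by the reflection [s |-> - s]
([right_primitive_expansion]): differentiating in a lower bound produces a minus
sign, which cancels the one in the definition of the right derivative. *)

Set Implicit Arguments.
Unset Strict Implicit.
Unset Printing Implicit Defensive.

(** * The Gamma function: functional equation and growth *)

Section gamma.
Context {R : realType}.
Notation mu := (@lebesgue_measure R).
Implicit Types z t M : R.

Definition gamma_integrand z t : R := t `^ (z - 1) * expR (- t).

(** The Gamma integral with values in the extended reals: the functional equation
holds there before convergence is known, and convergence is deduced from it. *)
Definition eGamma z : \bar R :=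
  (\int[mu]_(t in `]0%R, +oo[) (gamma_integrand z t)%:E)%E.

Lemma gamma_integrand_ge0 z t : 0 <= gamma_integrand z t.
Proof. by rewrite mulr_ge0 ?powR_ge0 ?expR_ge0. Qed.

Lemma measurable_gamma_integrand z D : measurable_fun D (gamma_integrand z).
Proof.
apply: measurable_funTS; apply: measurable_funM; first exact: measurable_powR.
by apply: measurableT_comp => //; exact: measurable_expR.
Qed.

Lemma continuous_powR z t : 0 < t -> {for t, continuous (fun t : R => t `^ z)}.
Proof.
move=> t0; apply: differentiable_continuous; apply/derivable1_diffP.
by apply: derivable_powR; rewrite in_itv/= t0.
Qed.

Lemma continuous_expRN : continuous (fun t : R => expR (- t)).
Proof.
move=> t; apply: (@continuous_comp _ _ _ (@GRing.opp R) expR).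
  exact: opp_continuous.
exact: continuous_expR.
Qed.

Lemma is_derive_NexpRN t : is_derive t 1 (fun t : R => - expR (- t)) (expR (- t)).
Proof. by apply: is_derive_eq; rewrite mulrN1 opprK. Qed.

Lemma continuous_gamma_integrand z t :
  0 < t -> {for t, continuous (gamma_integrand z)}.
Proof.
move=> t0; apply: cvgM; first exact: continuous_powR.
exact: continuous_expRN.
Qed.

(** Compact intervals exhausting the open half-line; starting at n + 2 keeps them
nondegenerate, so that integration by parts applies to each of them. *)
Let trunc (n : nat) : set R := `[n.+2%:R^-1, n.+2%:R].

Lemma bigcup_trunc : \bigcup_n trunc n = `]0, +oo[%classic.
Proof.
apply/seteqP; split => t /=.
  move=> [n _]; rewrite /trunc/= !in_itv/= andbT => /andP[+ _].
  by apply: lt_le_trans; rewrite invr_gt0.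
rewrite in_itv/= andbT => t0.
exists (Num.truncn (t + t^-1)) => //; rewrite /trunc/= in_itv/=.
have H : t + t^-1 < (Num.truncn (t + t^-1)).+2%:R.
  by rewrite (lt_le_trans (truncnS_gt _))// ler_nat.
have ti0 : 0 < t^-1 by rewrite invr_gt0.
apply/andP; split; last by rewrite (le_trans _ (ltW H))// lerDl ltW.
rewrite -[leRHS]invrK lef_pV2 ?posrE//.
by rewrite (le_trans _ (ltW H))// lerDr ltW.
Qed.

Lemma cvg_trunc_eGamma z :
  (\int[mu]_(t in trunc n) (gamma_integrand z t)%:E)%E @[n --> \oo] --> eGamma z.
Proof.
rewrite /eGamma -bigcup_trunc; apply: ge0_nondecreasing_set_cvg_integral => //.
- move=> m n mn; rewrite subsetEset => t; rewrite /trunc/= !in_itv/=.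
  move=> /andP[a b]; rewrite (le_trans _ a) ?(le_trans b)// ?ler_nat//.
  by rewrite lef_pV2 ?posrE ?ler_nat.
- by move=> n; exact: measurable_itv.
- by move=> n; apply/measurable_EFinP; exact: measurable_gamma_integrand.
- by move=> n t _; rewrite lee_fin gamma_integrand_ge0.
Qed.

Let boundary_term z (n : nat) : R :=
  gamma_integrand (z + 1) n.+2%:R - gamma_integrand (z + 1) n.+2%:R^-1.

(** Integration by parts, with [- expR (- t)] as antiderivative of [expR (- t)]. *)
Lemma truncated_by_parts z n : 0 < z ->
  (\int[mu]_(t in trunc n) (gamma_integrand (z + 1) t)%:E =
   z%:E * \int[mu]_(t in trunc n) (gamma_integrand z t)%:E -
   (boundary_term z n)%:E)%E.
Proof.
move=> z0; rewrite /trunc.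
set a : R := n.+2%:R^-1; set b : R := n.+2%:R.
have a0 : 0 < a by rewrite invr_gt0.
have ab : a < b by rewrite (@lt_trans _ _ 1)// ?invf_lt1 ?ltr1n.
have pos t : t \in `[a, b] -> 0 < t.
  by rewrite in_itv/= => /andP[+ _]; exact: lt_le_trans.
have cF t : 0 < t -> {for t, continuous (fun t : R => t `^ z)} by exact: continuous_powR.
have dG := is_derive_NexpRN.
have cG t : {for t, continuous (fun t => - expR (- t))}.
  by apply: cvgN; exact: continuous_expRN.
have := @integration_by_parts R (fun t => t `^ z) (fun t => - expR (- t))
  (fun t => z * t `^ (z - 1)) (fun t => expR (- t)) a b ab.
have -> : (\int[mu]_(x in `[a, b]) (z * x `^ (z - 1) * - expR (- x))%:E
   = - (z%:E * \int[mu]_(t in `[a, b]) (gamma_integrand z t)%:E))%E.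
  rewrite -mulNe -EFinN -integralZl//=; last first.
    apply: continuous_compact_integrable; first exact: segment_compact.
    apply: continuous_in_subspaceT => t /set_mem/pos.
    exact: continuous_gamma_integrand.
  apply: eq_integral => t _; rewrite -EFinM /gamma_integrand.
  by congr EFin; rewrite !mulrN !mulNr mulrA.
rewrite oppeK addeC => H.
rewrite -[X in (_ + X)%E]EFinN.
have -> : (- boundary_term z n) = (b `^ z * - expR (- b) - a `^ z * - expR (- a)).
  rewrite /boundary_term /gamma_integrand !addrK -/a -/b; lra.
rewrite -H.
- by apply: eq_integral => t _; rewrite /gamma_integrand addrK.
- apply: continuous_in_subspaceT => t /set_mem/pos t0.
  by apply: cvgM; [exact: cvg_cst|exact: continuous_powR].
- split.
  + move=> t; rewrite in_itv/= => /andP[at0 _]; apply: derivable_powR.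
    by rewrite in_itv/= andbT (lt_trans a0).
  + by apply: cvg_at_right_filter; exact: continuous_powR.
  + by apply: cvg_at_left_filter; apply: continuous_powR; exact: lt_trans ab.
- move=> t; rewrite in_itv/= => /andP[at0 _]; rewrite powR_derive1//.
  by rewrite in_itv/= andbT (lt_trans a0).
- exact/continuous_subspaceT/continuous_expRN.
- split.
  + by move=> t _; exact: ex_derive.
  + by apply: cvg_at_right_filter; exact: cG.
  + by apply: cvg_at_left_filter; exact: cG.
- by move=> t _; rewrite derive1E derive_val.
Qed.


Lemma cvg_inv_natS2 : (n.+2%:R^-1 : R) @[n --> \oo] --> (0 : R).
Proof.
by have := @cvg_harmonic R; rewrite -cvg_shiftS.
Qed.

(** From [expR b >= b ^+ k.+1 / k.+1`!], an exponential beats every power. *)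
Lemma gamma_integrand_tail z (k n : nat) : z <= k%:R ->
  gamma_integrand (z + 1) n.+2%:R <= k.+1`!%:R * n.+2%:R^-1.
Proof.
move=> zk; rewrite /gamma_integrand addrK.
set b : R := n.+2%:R.
have b0 : 0 < b by rewrite ltr0n.
have -> : b^-1 = b ^+ k * b ^- k.+1.
  by rewrite exprS invfM mulrCA mulfV ?mulr1// expf_neq0 ?gt_eqF.
apply: (@le_trans _ _ (b ^+ k * expR (- b))).
  rewrite ler_pM2r ?expR_gt0// -(powR_mulrn _ (ltW b0)).
  by apply: ler_powR => //; rewrite ler1n.
rewrite mulrCA ler_pM2l ?exprn_gt0// expRN -[leRHS]invrK.
rewrite lef_pV2 ?posrE ?expR_gt0//; last first.
  by rewrite invr_gt0 mulr_gt0 ?ltr0n ?fact_gt0// invr_gt0 exprn_gt0.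
rewrite invfM invrK mulrC (le_trans _ (expR_ge1Dxn k (ltW b0)))//.
by rewrite lerDr.
Qed.

Lemma cvg_boundary_term z : 0 < z -> boundary_term z n @[n --> \oo] --> (0 : R).
Proof.
move=> z0; rewrite -[X in _ --> X]subr0; apply: cvgB.
  pose k := (Num.truncn z).+1.
  have zk : z <= k%:R by rewrite ltW// truncnS_gt.
  apply: (@squeeze_cvgr _ _ _ _ (cst 0) (fun n => k.+1`!%:R * n.+2%:R^-1)).
  - by apply: nearW => n; rewrite gamma_integrand_ge0/= gamma_integrand_tail.
  - exact: cvg_cst.
  - rewrite -[X in _ --> X](mulr0 k.+1`!%:R).
    by apply: cvgM; [exact: cvg_cst|exact: cvg_inv_natS2].
apply: (@squeeze_cvgr _ _ _ _ (cst 0) (fun n : nat => n.+2%:R^-1 `^ z)).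
- apply: nearW => n; rewrite gamma_integrand_ge0/= /gamma_integrand addrK.
  by rewrite ler_piMr ?powR_ge0// expR_le1 oppr_le0 invr_ge0.
- exact: cvg_cst.
- have /cvg_at_rightP := powR_cvg0 z0.
  by apply; split; [move=> n; rewrite invr_gt0|exact: cvg_inv_natS2].
Qed.

Lemma eGamma_ge0 z : (0 <= eGamma z)%E.
Proof. by apply: integral_ge0 => t _; rewrite lee_fin gamma_integrand_ge0. Qed.

(** Limit of [truncated_by_parts]: both integrals converge by monotone
convergence, and the boundary term vanishes. *)
Lemma eGammaD1 z : 0 < z -> eGamma (z + 1) = (z%:E * eGamma z)%E.
Proof.
move=> z0; rewrite -(cvg_lim _ (@cvg_trunc_eGamma (z + 1)))//.
under eq_fun do rewrite (truncated_by_parts _ z0).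
rewrite -[RHS]sube0; apply: cvg_lim => //; apply: cvgeB.
- by apply: fin_num_adde_defl.
- by apply: cvgeZl => //; exact: cvg_trunc_eGamma.
- by apply: cvg_EFin; [exact: nearW|exact: cvg_boundary_term].
Qed.

Lemma eGamma1 : eGamma 1 = 1%E.
Proof.
rewrite /eGamma integral_itv_obnd_cbnd; last first.
  by apply/measurable_EFinP; exact: measurable_gamma_integrand.
under eq_integral do rewrite /gamma_integrand subrr powRr0 mul1r.
have dG := is_derive_NexpRN.
rewrite (@ge0_continuous_FTC2y _ _ (fun t : R => - expR (- t)) 0 0).
- by rewrite oppr0 expR0 EFinN oppeK add0e.
- by move=> t _; exact: expR_ge0.
- exact/continuous_subspaceT/continuous_expRN.
- by rewrite -[X in _ --> X]oppr0; apply: cvgN; exact: cvgr_expR.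
- by move=> t _; exact: ex_derive.
- by apply: cvg_at_right_filter; apply: cvgN; exact: continuous_expRN.
- by move=> t _; rewrite derive1E derive_val.
Qed.

Lemma eGamma_natS (n : nat) : eGamma n.+1%:R \is a fin_num.
Proof.
elim: n => [|n IH]; first by rewrite eGamma1.
by rewrite -natr1 eGammaD1// fin_numM.
Qed.

(** By the functional equation it is enough to bound the integral at [z + 1],
where the integrand is at most the sum of those at [1] and [k + 1] as soon as
[k >= z]; at positive integers the functional equation gives finiteness by
induction from [eGamma1]. *)
Lemma eGamma_fin_num z : 0 < z -> eGamma z \is a fin_num.
Proof.
move=> z0.
suff : (eGamma (z + 1) < +oo)%E.
  rewrite eGammaD1// => H; rewrite ge0_fin_numE ?eGamma_ge0//.
  by move: H; rewrite !ltey; apply: contra => /eqP ->; rewrite gt0_muley.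
pose k := (Num.truncn z).+1.
have zk : z <= k%:R by rewrite ltW// truncnS_gt.
apply: (@le_lt_trans _ _ (eGamma 1 + eGamma k.+1%:R)%E); last first.
  by rewrite lte_add_pinfty// -ge0_fin_numE ?eGamma_ge0 ?eGamma1 ?eGamma_natS.
rewrite -ge0_integralD//; last 4 first.
- by move=> t _; rewrite lee_fin gamma_integrand_ge0.
- by apply/measurable_EFinP; exact: measurable_gamma_integrand.
- by move=> t _; rewrite lee_fin gamma_integrand_ge0.
- by apply/measurable_EFinP; exact: measurable_gamma_integrand.
apply: ge0_le_integral => //.
- by move=> t _; rewrite lee_fin gamma_integrand_ge0.
- by apply/measurable_EFinP; exact: measurable_gamma_integrand.
- by apply/measurable_EFinP; apply: measurable_funD; exact: measurable_gamma_integrand.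
move=> t /=; rewrite in_itv/= andbT => t0; rewrite lee_fin /gamma_integrand.
rewrite -mulrDl ler_pM2r ?expR_gt0// addrK subrr powRr0 -natr1 addrK.
have [t1|t1] := leP t 1.
  rewrite (@le_trans _ _ 1) ?lerDl ?powR_ge0//.
  by rewrite -(powRr0 t) ger_powR ?t0// ltW.
by rewrite (@le_trans _ _ (t `^ k%:R)) ?lerDr// ler_powR// ltW.
Qed.

Lemma EFin_Gamma z : 0 < z -> (Gamma z)%:E = eGamma z.
Proof. by move=> z0; rewrite /Gamma /Rintegral fineK// eGamma_fin_num. Qed.

Lemma GammaD1 z : 0 < z -> Gamma (z + 1) = z * Gamma z.
Proof.
move=> z0; apply: EFin_inj; rewrite EFinM !EFin_Gamma ?ltr_wpDl ?ltW//.
exact: eGammaD1.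
Qed.

Lemma Gamma1 : Gamma 1 = 1 :> R.
Proof. by apply: EFin_inj; rewrite EFin_Gamma ?eGamma1. Qed.

(** On [[M, M + 1]] the integrand is at least this constant. As [M] is free, this
says that Gamma outgrows every geometric sequence, which is what makes the
Mittag-Leffler series converge everywhere. *)
Lemma Gamma_lower_bound M z : 0 < M -> 0 <= z ->
  M `^ z * expR (- (M + 1)) <= Gamma (z + 1).
Proof.
move=> M0 z0; rewrite -lee_fin EFin_Gamma ?ltr_wpDl//.
set c := _ * _.
have -> : c%:E = (\int[mu]_(t in `[M, (M + 1)%R]) cst c%:E t)%E.
  rewrite integral_cst//= lebesgue_measure_itv/= lte_fin ltrDl ltr01 -EFinB.
  by rewrite addrC addKr mule1.
apply: (@le_trans _ _ (\int[mu]_(t in `[M, (M + 1)%R]) (gamma_integrand (z + 1) t)%:E)%E).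
  apply: ge0_le_integral => //.
  - by move=> t _; rewrite lee_fin mulr_ge0 ?powR_ge0 ?expR_ge0.
  - by apply/measurable_EFinP; exact: measurable_gamma_integrand.
  - move=> t /=; rewrite in_itv/= => /andP[Mt tM]; rewrite lee_fin.
    rewrite /gamma_integrand addrK; apply: ler_pM; rewrite ?powR_ge0 ?expR_ge0//.
      by apply: ge0_ler_powR; rewrite ?nnegrE// ltW// (lt_le_trans M0).
    by rewrite ler_expR lerN2.
apply: ge0_subset_integral => //.
- by apply/measurable_EFinP; exact: measurable_gamma_integrand.
- by move=> t _; rewrite lee_fin gamma_integrand_ge0.
- by move=> t /=; rewrite !in_itv/= andbT => /andP[+ _]; exact: lt_le_trans.
Qed.

Lemma Gamma_gt0 z : 0 < z -> 0 < Gamma z.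
Proof.
move=> z0; rewrite -(pmulr_rgt0 _ z0) -GammaD1//.
apply: lt_le_trans (@Gamma_lower_bound 1 z ltr01 (ltW z0)).
by rewrite mulr_gt0 ?powR_gt0 ?expR_gt0.
Qed.

End gamma.

(** * Power kernels and reflection of Lebesgue integrals *)

Section powers.
Context {R : realType}.
Notation mu := (@lebesgue_measure R).
Implicit Types (gam s t u L : R).

Lemma measurable_powR_kernel gam D :
  measurable_fun D (fun u : R => gam * u `^ (gam - 1)).
Proof.
by apply: measurable_funTS; apply: measurable_funM => //; exact: measurable_powR.
Qed.

(** For [gam < 1] the integrand is unbounded at the origin, so the fundamental
theorem of calculus is applied on [[L / (n + 2), L]] and one passes to the
limit by monotone convergence. *)
Lemma integral_powR_kernel gam L : 0 < gam -> 0 <= L ->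
  (\int[mu]_(u in `[0%R, L]) (gam * u `^ (gam - 1))%:E)%E = (L `^ gam)%:E.
Proof.
move=> g0; rewrite le_eqVlt => /predU1P[<-|L0].
  by rewrite set_itv1 integral_set1 powR0 // gt_eqF.
have mk D : measurable_fun D (fun u : R => (gam * u `^ (gam - 1))%:E).
  by apply/measurable_EFinP; exact: measurable_powR_kernel.
rewrite -integral_itv_obnd_cbnd//.
pose F (n : nat) : set R := `[L * n.+2%:R^-1, L]%classic.
have an0 n : 0 < L * n.+2%:R^-1 :> R by rewrite mulr_gt0// invr_gt0.
have anL n : L * n.+2%:R^-1 < L :> R.
  by rewrite gtr_pMr// invf_lt1 ?ltr0n ?ltr1n.
have -> : `]0, L]%classic = \bigcup_n F n.
  apply/seteqP; split => t /=; rewrite in_itv/=; last first.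
    move=> [n _]; rewrite /F/= in_itv/= => /andP[+ ->]; rewrite andbT.
    exact: lt_le_trans.
  move=> /andP[t0 tL]; exists (Num.truncn (L / t)) => //; rewrite /F/= in_itv/= tL andbT.
  rewrite ler_pdivrMr ?ltr0n// mulrC -ler_pdivrMr//.
  by rewrite ltW// (lt_le_trans (truncnS_gt _))// ler_nat.
have FE n : (\int[mu]_(u in F n) (gam * u `^ (gam - 1))%:E)%E =
    (L `^ gam - (L * n.+2%:R^-1) `^ gam)%:E.
  rewrite /F (@continuous_FTC2 _ _ (fun t => t `^ gam)) ?EFinB//.
  - apply: continuous_in_subspaceT => t /set_mem/=.
    rewrite in_itv/= => /andP[t0 _].
    apply: cvgM; first exact: cvg_cst.
    by apply: continuous_powR; exact: lt_le_trans t0.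
  - split.
    + move=> t; rewrite in_itv/= => /andP[t0 _]; apply: derivable_powR.
      by rewrite in_itv/= andbT (lt_trans (an0 n)).
    + by apply: cvg_at_right_filter; apply: continuous_powR.
    + by apply: cvg_at_left_filter; apply: continuous_powR.
  - move=> t; rewrite in_itv/= => /andP[t0 _]; rewrite powR_derive1//.
    by rewrite in_itv/= andbT (lt_trans (an0 n)).
have lim0 : (L * n.+2%:R^-1) `^ gam @[n --> \oo] --> (0 : R).
  have /cvg_at_rightP := powR_cvg0 g0; apply; split => //.
  rewrite -[X in _ --> X](mulr0 L); apply: cvgM; first exact: cvg_cst.
  exact: cvg_inv_natS2.
have lim : (L `^ gam - (L * n.+2%:R^-1) `^ gam)%:E @[n --> \oo]
    --> (L `^ gam)%:E.
  apply: cvg_EFin; first exact: nearW.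
  by rewrite -[X in _ --> X]subr0; apply: cvgB => //; exact: cvg_cst.
rewrite -(cvg_lim _ lim)//; apply/esym/cvg_lim => //.
under eq_fun do rewrite -FE.
apply: ge0_nondecreasing_set_cvg_integral.
- move=> m n mn; rewrite subsetEset => t; rewrite /F/= !in_itv/=.
  move=> /andP[a ->]; rewrite andbT (le_trans _ a)// ler_pM2l//.
  by rewrite lef_pV2 ?posrE ?ler_nat.
- by move=> n; exact: measurable_itv.
- by move=> n; exact: mk.
- move=> n t; rewrite /F/= in_itv/= => /andP[t0 _].
  by rewrite lee_fin mulr_ge0 ?powR_ge0 ?ltW.
Qed.

Lemma integrable_powR_kernel gam L : 0 < gam ->
  mu.-integrable `[0, L] (fun u => (gam * u `^ (gam - 1))%:E).
Proof.
move=> g0; have [L0|L0] := leP 0 L; last first.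
  by rewrite set_itv_ge ?bnd_simp -?ltNge//; exact: integrable_set0.
apply/integrableP; split.
  by apply/measurable_EFinP; exact: measurable_powR_kernel.
under eq_integral => u _.
  rewrite /= ger0_norm; last by rewrite mulr_ge0 ?powR_ge0 ?ltW.
  over.
by rewrite integral_powR_kernel// ltry.
Qed.

(** Lebesgue measure is invariant under [u |-> c - u]; the positive and the negative
part are transported separately, each as a nonnegative function. *)
Lemma integral_reflect (phi : R -> \bar R) (c p q : R) :
  measurable_fun [set: R] phi ->
  (\int[mu]_(s in `[p, q]) phi s =
   \int[mu]_(u in `[(c - q)%R, (c - p)%R]) phi (c - u)%R)%E.
Proof.
move=> mphi.
pose r : measurableTypeR R -> measurableTypeR R := fun u => c - u.
have mr : measurable_fun [set: measurableTypeR R] r by exact: measurable_funB.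
have E (A : set R) : measurable A -> pushforward mu r A = mu A.
  move=> mA; apply/esym.
  apply: (@lebesgue_measure_unique _ (pushforward mu r)) => //= _ [[a b]] _ <-.
  rewrite /pushforward/=.
  have -> : r @^-1` `]a, b] = `[(c - b)%R, (c - a)%R[%classic.
    apply/seteqP; split => x; rewrite /r/= !in_itv/= => /andP[? ?];
      apply/andP; split; lra.
  rewrite !lebesgue_measure_itv/= !lte_fin ltrD2l ltrN2.
  by case: ifP => // _; congr EFin; ring.
have P : r @^-1` `[p, q] = `[(c - q)%R, (c - p)%R]%classic.
  apply/seteqP; split => x; rewrite /r/= !in_itv/= => /andP[? ?];
    apply/andP; split; lra.
have ge0 (psi : R -> \bar R) : measurable_fun [set: R] psi ->
    (forall x, (0 <= psi x)%E) ->
    (\int[mu]_(s in `[p, q]) psi s =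
     \int[mu]_(u in `[(c - q)%R, (c - p)%R]) psi (c - u)%R)%E.
  move=> mpsi psi0; rewrite -P.
  transitivity (\int[pushforward mu r]_(s in `[p, q]) psi s)%E.
    by apply: eq_measure_integral => //= A mA _; rewrite E.
  by rewrite (ge0_integral_pushforward mr)//; exact: measurable_funS mpsi.
rewrite integralE [RHS]integralE; congr (_ - _)%E.
- rewrite ge0//; last exact: measurable_funepos.
  by apply: eq_integral => u _; rewrite !funeposE.
- rewrite ge0//; last exact: measurable_funeneg.
  by apply: eq_integral => u _; rewrite !funenegE.
Qed.

End powers.

(** * Fractional integrals and their primitives *)

Section scaled.
Context {R : realType}.
Notation mu := (@lebesgue_measure R).
Implicit Types (gam s t u L a x : R).

(** The unweighted Riemann-Liouville integral of [g] of order [gam], multiplied by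
[Gamma (gam + 1)]: with this normalization it has the primitive of
[scaled_RL_primitive] and no Gamma factor appears before the series is formed.
As for the weighted integrals, order zero is the identity. *)
Definition scaled_RL gam a (g : R -> R) t : R :=
  if gam == 0 then g t
  else \int[mu]_(s in `[a, t]) (gam * (t - s) `^ (gam - 1) * g s).

Lemma measurable_shifted_kernel gam t D :
  measurable_fun D (fun s : R => gam * (t - s) `^ (gam - 1)).
Proof.
apply: measurable_funTS; apply: measurable_funM => //.
by apply: (measurableT_comp (@measurable_powR R (gam - 1))); exact: measurable_funB.
Qed.

Lemma integral_left_kernel gam a t : 0 < gam -> a <= t ->
  (\int[mu]_(s in `[a, t]) (gam * (t - s) `^ (gam - 1))%:E)%E
  = ((t - a) `^ gam)%:E.
Proof.
move=> g0 at0; rewrite (@integral_reflect _ _ t)/=; last first.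
  by apply/measurable_EFinP; exact: measurable_shifted_kernel.
rewrite subrr -integral_powR_kernel ?subr_ge0//.
by apply: eq_integral => u _; rewrite opprB addrCA subrr addr0.
Qed.

Lemma integral_right_kernel gam s x : 0 < gam -> s <= x ->
  (\int[mu]_(t in `[s, x]) (gam * (t - s) `^ (gam - 1))%:E)%E
  = ((x - s) `^ gam)%:E.
Proof.
move=> g0 sx; rewrite (@integral_reflect _ _ (s + x))/=; last first.
  apply/measurable_EFinP; apply: measurable_funM => //.
  apply: (measurableT_comp (@measurable_powR R (gam - 1))).
  exact: measurable_funB.
have -> : s + x - x = s by ring.
have -> : s + x - s = x by ring.
rewrite -integral_left_kernel//.
by apply: eq_integral => u _; congr ((_ * _ `^ _)%:E); ring.
Qed.

Variables (g : R -> R) (M : R).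
Hypothesis cg : continuous g.
Hypothesis gM : forall s, `|g s| <= M.

Lemma sup_bound_ge0 : 0 <= M.
Proof. exact: le_trans (normr_ge0 _) (gM 0). Qed.

Lemma continuous_measurable_funTS D : measurable_fun D g.
Proof. by apply: measurable_funTS; exact: continuous_measurable_fun. Qed.

Lemma kernel_mul_le gam t s : 0 < gam ->
  `|gam * (t - s) `^ (gam - 1) * g s| <= M * (gam * (t - s) `^ (gam - 1)).
Proof.
move=> g0; rewrite normrM mulrC [X in _ * X]ger0_norm; last first.
  by rewrite mulr_ge0 ?powR_ge0 ?ltW.
by rewrite ler_wpM2r// mulr_ge0 ?powR_ge0 ?ltW.
Qed.

Lemma integrable_left_kernel gam a t : 0 < gam ->
  mu.-integrable `[a, t] (fun s => (gam * (t - s) `^ (gam - 1))%:E).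
Proof.
move=> g0; have [at0|ta] := leP a t; last first.
  by rewrite set_itv_ge ?bnd_simp -?ltNge//; exact: integrable_set0.
apply/integrableP; split.
  by apply/measurable_EFinP; exact: measurable_shifted_kernel.
under eq_integral => u _.
  rewrite /= ger0_norm; last by rewrite mulr_ge0 ?powR_ge0 ?ltW.
  over.
by rewrite integral_left_kernel// ltry.
Qed.

Lemma integrable_left_kernel_mul gam a t : 0 < gam ->
  mu.-integrable `[a, t] (fun s => (gam * (t - s) `^ (gam - 1) * g s)%:E).
Proof.
move=> g0.
apply: (@le_integrable _ _ _ mu _ _ _
  (fun s => M%:E * (gam * (t - s) `^ (gam - 1))%:E)%E) => //.
- apply/measurable_EFinP; apply: measurable_funM; last exact: continuous_measurable_funTS.
  exact: measurable_shifted_kernel.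
- move=> s _ /=; rewrite lee_fin (le_trans (kernel_mul_le _ _ g0))// ler_norm//.
- by apply: integrableZl => //; exact: integrable_left_kernel.
Qed.

Lemma scaled_RL_bound gam a t : 0 <= gam -> a <= t ->
  `|scaled_RL gam a g t| <= M * (t - a) `^ gam.
Proof.
rewrite /scaled_RL le_eqVlt eq_sym; case: eqP => [-> _ _|_ /= g0 at0].
  by rewrite powRr0 mulr1.
rewrite (le_trans (le_normr_Rintegral _ (integrable_left_kernel_mul a t g0)))//.
rewrite -lee_fin.
have ik := integrable_left_kernel a t g0.
have -> : M * (t - a) `^ gam =
   \int[mu]_(s in `[a, t]) (M * (gam * (t - s) `^ (gam - 1))).
  by rewrite RintegralZl// /Rintegral integral_left_kernel.
rewrite lee_fin; apply: le_Rintegral => //.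
- by have /integrable_norm := integrable_left_kernel_mul a t g0.
- by have := @integrableZl _ _ _ mu _ (measurable_itv _) M _ ik.
- by move=> s _; exact: kernel_mul_le.
Qed.

Let T := measurableTypeR R.

(** The integrand of [scaled_RL] restricted to the triangle [a <= s <= t <= x],
with [p = (t, s)], as a function on the whole plane. *)
Let triangle_kernel gam a x (p : T * T) : R :=
  if [&& a <= p.2, p.2 <= p.1 & p.1 <= x]
  then gam * (p.1 - p.2) `^ (gam - 1) * g p.2 else 0.

Lemma measurable_triangle_kernel gam a x : measurable_fun [set: T * T] (triangle_kernel gam a x).
Proof.
have m1 : measurable_fun [set: T * T] (fst : T * T -> T) by exact: measurable_fst.
have m2 : measurable_fun [set: T * T] (snd : T * T -> T) by exact: measurable_snd.
have mg : measurable_fun [set: T] (g : T -> R) by exact: continuous_measurable_funTS.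
apply: measurable_fun_ifT => //.
- apply: measurable_and; first exact: measurable_fun_ler.
  by apply: measurable_and; exact: measurable_fun_ler.
- apply: measurable_funM; last first.
    by apply: (measurableT_comp mg).
  apply: measurable_funM => //.
  apply: (measurableT_comp (@measurable_powR R (gam - 1))).
  exact: measurable_funB.
Qed.


Lemma integrable_right_kernel gam s x : 0 < gam ->
  mu.-integrable `[s, x] (fun t => (gam * (t - s) `^ (gam - 1))%:E).
Proof.
move=> g0; have [sx|xs] := leP s x; last first.
  by rewrite set_itv_ge ?bnd_simp -?ltNge//; exact: integrable_set0.
apply/integrableP; split.
  apply/measurable_EFinP; apply: measurable_funM => //.
  apply: (measurableT_comp (@measurable_powR R (gam - 1))).
  exact: measurable_funB.
under eq_integral => u _.
  rewrite /= ger0_norm; last by rewrite mulr_ge0 ?powR_ge0 ?ltW.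
  over.
by rewrite integral_right_kernel// ltry.
Qed.

Lemma triangle_kernel_fst gam a x t :
  (fun s => (triangle_kernel gam a x (t, s))%:E) =
  if t <= x
  then (fun s => (gam * (t - s) `^ (gam - 1) * g s)%:E) \_ `[a, t]
  else cst 0%E.
Proof.
apply/funext => s; rewrite /triangle_kernel/=.
have [tx|tx] := boolP (t <= x); last by rewrite !andbF.
by rewrite patchE mem_setE in_itv/= andbT; case: ifP.
Qed.

Lemma triangle_kernel_snd gam a x s :
  (fun t => (triangle_kernel gam a x (t, s))%:E) =
  if a <= s
  then (fun t => (gam * (t - s) `^ (gam - 1) * g s)%:E) \_ `[s, x]
  else cst 0%E.
Proof.
apply/funext => t; rewrite /triangle_kernel/=; have [as0|//] := boolP (a <= s).
by rewrite patchE mem_setE in_itv/=; case: ifP.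
Qed.

(** Integrating the absolute value in [s] first leaves at most
[M * (t - a) `^ gam], a bounded function of [t]. *)
Lemma integrable_triangle_kernel gam a x : 0 < gam -> a <= x ->
  (mu \x mu)%E.-integrable [set: T * T] (EFin \o triangle_kernel gam a x).
Proof.
move=> g0 ax; apply/integrable12ltyP.
  by apply/measurable_EFinP; exact: measurable_triangle_kernel.
pose C := M * (x - a) `^ gam.
have C0 : 0 <= C by rewrite mulr_ge0 ?powR_ge0// sup_bound_ge0.
apply: (@le_lt_trans _ _ (\int[mu]_(t in `[a, x]) (cst C%:E t))%E); last first.
  rewrite integral_cst//= lebesgue_measure_itv/= lte_fin.
  by case: ifP => _; rewrite ?mule0 -?EFinB -?EFinM ltry.
rewrite [leRHS]integral_mkcond; apply: ge0_le_integral => //.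
- by move=> t _; exact: integral_ge0.
- apply: (@measurable_fun_fubini_tonelli_F _ _ T T R mu
    (fun p => `|(triangle_kernel gam a x p)%:E|%E)) => //.
  apply: measurableT_comp => //; apply/measurable_EFinP.
  exact: measurable_triangle_kernel.
- by apply/(measurable_restrictT _ _).1 => //; exact: measurable_cst.
move=> t _; rewrite patchE mem_setE in_itv/=.
have E : (fun s => `|(triangle_kernel gam a x (t, s))%:E|%E) =
  (fun s => `|(if (t <= x)%R
    then (fun s => (gam * (t - s) `^ (gam - 1) * g s)%:E) \_ `[a, t]
    else cst 0%E) s|%E).
  by rewrite -triangle_kernel_fst.
rewrite /= E.
have [tx|xt] := leP t x; last first.
  rewrite andbF; under eq_integral do rewrite abse0.
  by rewrite integral0.
have [at0|ta] := leP a t; last first.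
  rewrite set_itv_ge ?bnd_simp -?ltNge//.
  rewrite patch_set0; under eq_integral do rewrite abse0.
  by rewrite integral0.
rewrite [leLHS](_ : _ = \int[mu]_(s in `[a, t])
    `|(gam * (t - s) `^ (gam - 1) * g s)%:E|)%E; last first.
  rewrite [RHS]integral_mkcond; apply: eq_integral => s _.
  by rewrite !patchE; case: ifP => //; rewrite abse0.
apply: (@le_trans _ _ (\int[mu]_(s in `[a, t])
    (M%:E * (gam * (t - s) `^ (gam - 1))%:E))%E).
  apply: ge0_le_integral => //.
  - apply: measurableT_comp => //.
    by have /integrableP[] := integrable_left_kernel_mul a t g0.
  - apply/measurable_EFinP; apply: measurable_funM => //.
    exact: measurable_shifted_kernel.
  - by move=> s _; rewrite lee_fin; exact: kernel_mul_le.
rewrite integralZl//=; last exact: integrable_left_kernel.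
rewrite integral_left_kernel// -EFinM lee_fin ler_wpM2l ?sup_bound_ge0//.
by apply: ge0_ler_powR; rewrite ?nnegrE ?subr_ge0 ?lerB// ltW.
Qed.

(** Fubini on the triangle: integrating the kernel [gam * (t - s) `^ (gam - 1)] in
[t] over [[s, x]] gives [(x - s) `^ gam]. This identity replaces a
differentiation under the integral sign, which the singularity of the kernel
would make delicate. *)
Lemma scaled_RL_primitive gam a x : 0 <= gam -> a <= x ->
  \int[mu]_(t in `[a, x]) scaled_RL gam a g t =
  \int[mu]_(s in `[a, x]) ((x - s) `^ gam * g s).
Proof.
rewrite le_eqVlt => /predU1P[<- _|g0 ax].
  by apply: eq_Rintegral => s _; rewrite /scaled_RL eqxx powRr0 mul1r.
congr fine.
have := Fubini (integrable_triangle_kernel g0 ax).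
have -> : (fun t => \int[mu]_s (EFin \o triangle_kernel gam a x) (t, s))%E =
    (fun t => (scaled_RL gam a g t)%:E) \_ `[a, x].
  apply/funext => t /=; rewrite triangle_kernel_fst patchE mem_setE in_itv/=.
  have [tx|tx] := boolP (t <= x); last by rewrite andbF integral0.
  rewrite andbT -integral_mkcond; case: ifPn => [at0|]; last first.
    by rewrite -ltNge => ta; rewrite set_itv_ge ?bnd_simp -?ltNge// integral_set0.
  rewrite /scaled_RL gt_eqF// fineK//.
  by apply: integrable_fin_num => //; exact: integrable_left_kernel_mul.
have -> : (fun s => \int[mu]_t (EFin \o triangle_kernel gam a x) (t, s))%E =
    (fun s => ((x - s) `^ gam * g s)%:E) \_ `[a, x].
  apply/funext => s /=; rewrite triangle_kernel_snd patchE mem_setE in_itv/=.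
  have [as0|as0] := boolP (a <= s); last by rewrite integral0.
  rewrite -integral_mkcond /=; case: ifPn => [sx|]; last first.
    by rewrite -ltNge => xs; rewrite set_itv_ge ?bnd_simp -?ltNge// integral_set0.
  under eq_integral do rewrite EFinM.
  rewrite integralZr//; last exact: integrable_right_kernel.
  by rewrite integral_right_kernel// EFinM.
by rewrite -!integral_mkcond.
Qed.

End scaled.

(** * Continuity of fractional integrals *)

Section continuity.
Context {R : realType}.
Notation mu := (@lebesgue_measure R).
Variables (g : R -> R) (M : R).
Implicit Types (gam L a t y : R).
Hypothesis cg : continuous g.
Hypothesis gM : forall s, `|g s| <= M.

Lemma integrable_kernel_bounded gam L (G : R -> R) :
  0 < gam -> measurable_fun [set: R] G -> (forall s, `|G s| <= M) ->
  mu.-integrable `[0, L] (fun u => (gam * u `^ (gam - 1) * G u)%:E).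
Proof.
move=> g0 mG GM.
apply: (@le_integrable _ _ _ mu _ _ _
  (fun s => M%:E * (gam * s `^ (gam - 1))%:E)%E) => //.
- apply/measurable_EFinP; apply: measurable_funM; last exact: measurable_funS mG.
  exact: measurable_powR_kernel.
- move=> s _ /=; rewrite lee_fin.
  rewrite normrM mulrC [X in _ * X]ger0_norm; last first.
    by rewrite mulr_ge0 ?powR_ge0 ?ltW.
  rewrite (le_trans _ (ler_norm _))// ler_wpM2r//.
  by rewrite mulr_ge0 ?powR_ge0 ?ltW.
- by apply: integrableZl => //; exact: integrable_powR_kernel.
Qed.

(** [g] made constant to the left of [a], which keeps it continuous and lets a
convolution run over a fixed interval. *)
Let left_flat a y : R := g (Num.max y a).

Lemma continuous_left_flat a : continuous (left_flat a).
Proof.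
move=> y; apply: (@continuous_comp _ _ _ (fun y : R => Num.max y a) g); last exact: cg.
by apply: continuous_max; [exact: cvg_id|exact: cvg_cst].
Qed.

Lemma continuous_left_flat_shift a y : continuous (fun u => left_flat a (y - u)).
Proof.
move=> u; apply: (@continuous_comp _ _ _ (fun u : R => y - u) (left_flat a)).
  by apply: continuousB; [exact: cvg_cst|exact: cvg_id].
exact: continuous_left_flat.
Qed.

(** After the substitution [u = y - s] the singularity of the kernel no longer
moves with [y]. Extending the interval of integration from [[0, y - a]] to
[[0, L]] adds a part where [left_flat] is the constant [g a], which is
subtracted explicitly. *)
Lemma scaled_RL_convolution gam a L y : 0 < gam -> a <= y <= a + L ->
  scaled_RL gam a g y =
  \int[mu]_(u in `[0, L]) (gam * u `^ (gam - 1) * left_flat a (y - u))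
  - g a * (L `^ gam - (y - a) `^ gam).
Proof.
move=> g0 /andP[ay yL].
have L0 : 0 <= L by lra.
have y0 : 0 <= y - a by rewrite subr_ge0.
have iL : mu.-integrable `[0, L]
    (EFin \o (fun u => gam * u `^ (gam - 1) * left_flat a (y - u))).
  apply: integrable_kernel_bounded => // [|s]; last exact: gM.
  by apply: continuous_measurable_fun; exact: continuous_left_flat_shift.
have iK : mu.-integrable `[0, L] (EFin \o (fun u => gam * u `^ (gam - 1))).
  exact: integrable_powR_kernel.
have b1 : (BLeft 0 <= BRight (y - a))%O by rewrite bnd_simp.
have b2 : (BRight (y - a) <= BRight L)%O by rewrite bnd_simp; lra.
have -> : L `^ gam - (y - a) `^ gam =
    \int[mu]_(u in `](y - a), L]) (gam * u `^ (gam - 1)).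
  rewrite -(Rintegral_itvB iK)//.
  by rewrite /Rintegral !integral_powR_kernel.
rewrite -RintegralZl//; last first.
  apply: integrableS iK => //; apply: subset_itvr.
  by rewrite bnd_simp.
have -> : \int[mu]_(u in `](y - a), L]) (g a * (gam * u `^ (gam - 1))) =
    \int[mu]_(u in `](y - a), L]) (gam * u `^ (gam - 1) * left_flat a (y - u)).
  apply: eq_Rintegral => u /set_mem/=; rewrite in_itv/= => /andP[yu _].
  have yua : y - u <= a by rewrite lerBlDr addrC -lerBlDr ltW.
  by rewrite /left_flat (max_r yua) mulrC.
rewrite -(Rintegral_itvB iL)// opprB addrCA subrr addr0.
rewrite /scaled_RL gt_eqF//; congr fine.
rewrite (@integral_reflect _ _ y)/=; last first.
  apply/measurable_EFinP; apply: measurable_funM.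
    exact: measurable_shifted_kernel.
  exact: continuous_measurable_fun.
rewrite subrr; apply: eq_integral => u /set_mem/=; rewrite in_itv/= => /andP[u0 uy].
have yua : a <= y - u by rewrite lerBrDl -lerBrDr.
rewrite /left_flat (max_l yua).
by congr ((_ * _ `^ _ * _)%:E); ring.
Qed.

(** In [scaled_RL_convolution] the variable only enters through a continuous
function, so dominated convergence applies. *)
Lemma scaled_RL_continuous gam a t : 0 <= gam -> a < t ->
  {for t, continuous (scaled_RL gam a g)}.
Proof.
rewrite le_eqVlt => /predU1P[<- _|g0 a_t].
  have -> : scaled_RL 0 a g = g by apply/funext => s; rewrite /scaled_RL eqxx.
  exact: cg.
(* any length that puts t in the interior of [a, a + L] *)
pose L := t - a + 1.
have tI : t \in `]a, (a + L)%R[ by rewrite in_itv/= a_t /L; lra.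
pose F y := \int[mu]_(u in `[0, L]) (gam * u `^ (gam - 1) * left_flat a (y - u))
  - g a * (L `^ gam - (y - a) `^ gam).
have FE y : y \in `]a, (a + L)%R[ -> F y = scaled_RL gam a g y.
  rewrite in_itv/= => /andP[/ltW ay /ltW yL].
  by rewrite (@scaled_RL_convolution _ _ L)// ay.
rewrite /prop_for /continuous_at -(FE _ tI).
apply: cvg_trans.
  apply: (@near_eq_cvg _ _ _ _ F).
  near=> y; apply: FE; near: y; exact: near_in_itvoo.
apply: cvgB; last first.
  apply: cvgM; first exact: cvg_cst.
  apply: cvgB; first exact: cvg_cst.
  apply: (@continuous_comp _ _ _ (fun y : R => y - a) (fun y : R => y `^ gam)).
    by apply: continuousB; [exact: cvg_id|exact: cvg_cst].
  by apply: continuous_powR; rewrite subr_gt0.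
pose f y u := gam * u `^ (gam - 1) * left_flat a (y - u).
apply: (@continuity_under_integral _ _ _ mu f `[0, L]
  (measurable_itv _) a (a + L) _ _ (fun u => M * (gam * u `^ (gam - 1)))).
- move=> y _; apply: integrable_kernel_bounded => // [|s]; last exact: gM.
  by apply: continuous_measurable_fun; exact: continuous_left_flat_shift.
- apply: aeW => u _ y _; apply: cvgM; first exact: cvg_cst.
  apply: (@continuous_comp _ _ _ (fun y : R => y - u) (left_flat a)).
    by apply: continuousB; [exact: cvg_id|exact: cvg_cst].
  exact: continuous_left_flat.
- have := @integrableZl _ _ _ mu _ (measurable_itv _) M _ (integrable_powR_kernel L g0).
  by [].
- move=> y _; apply: aeW => u _; rewrite /f normrM mulrC [X in _ * X]ger0_norm; last first.
    by rewrite mulr_ge0 ?powR_ge0 ?ltW.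
  by rewrite ler_wpM2r ?gM// mulr_ge0 ?powR_ge0 ?ltW.
- by rewrite inE.
Unshelve. all: by end_near. Qed.

Lemma measurable_scaled_RL gam a y : 0 <= gam ->
  measurable_fun `[a, y] (scaled_RL gam a g).
Proof.
move=> g0.
have m1 : measurable_fun `]a, +oo[ (scaled_RL gam a g).
  apply: open_continuous_measurable_fun => // t.
  by rewrite inE/= in_itv/= andbT; exact: scaled_RL_continuous.
apply/measurable_fun_itv_obnd_cbndP; apply: measurable_funS m1 => //.
exact: subset_itvl.
Qed.

End continuity.

(** * Dominated series of functions *)

Section series_of_functions.
Context {R : realType}.
Notation mu := (@lebesgue_measure R).

Lemma dominated_series_cvg (u A : R^nat) :
  (forall j, `|u j| <= A j) -> cvgn (series A) -> cvgn (series u).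
Proof.
move=> uA cA; apply: normed_cvg; apply: series_le_cvg cA => j //=.
by apply: le_trans (uA j).
Qed.

Lemma dominated_series_tail (u A : R^nat) N :
  (forall j, `|u j| <= A j) -> cvgn (series A) ->
  `|limn (series u) - series u N| <= limn (series A) - series A N.
Proof.
move=> uA cA; have cu := dominated_series_cvg uA cA.
have c1 : `|series u n - series u N| @[n --> \oo]
    --> `|limn (series u) - series u N|.
  by apply: cvg_norm; apply: cvgB => //; exact: cvg_cst.
have c2 : series A n - series A N @[n --> \oo] --> limn (series A) - series A N.
  by apply: cvgB => //; exact: cvg_cst.
rewrite -(cvg_lim _ c1)// -(cvg_lim _ c2)//.
apply: ler_lim; [by apply: cvgP c1|by apply: cvgP c2|].
near=> n; rewrite !sub_series.
have -> : (N <= n)%N by near: n; exact: nbhs_infty_ge.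
by rewrite (le_trans (ler_norm_sum _ _ _))//; apply: ler_sum => j _.
Unshelve. all: by end_near. Qed.

Lemma dominated_series_le (u A : R^nat) N :
  (forall j, `|u j| <= A j) -> cvgn (series A) ->
  `|series u N| <= limn (series A).
Proof.
move=> uA cA; rewrite (@le_trans _ _ (series A N))//.
  by rewrite (le_trans (ler_norm_sum _ _ _))//; apply: ler_sum => j _.
apply: nondecreasing_cvgn_le => //; apply: nondecreasing_series => j _ _.
exact: le_trans (uA j).
Qed.

(** The Weierstrass M-test at a point: the difference splits into two tails of the
series and the variation of one partial sum, each at most [e / 3]. *)
Lemma continuous_series (h : nat -> R -> R) (A : R^nat) t :
  (forall j, {for t, continuous (h j)}) ->
  (\forall y \near t, forall j, `|h j y| <= A j) ->
  cvgn (series A) ->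
  {for t, continuous (fun y => limn (series (h ^~ y)))}.
Proof.
move=> ch hA cA; have htA := nbhs_singleton hA.
apply/cvgrPdist_le => e e0.
have e3 : 0 < e / 3 by rewrite divr_gt0.
have /cvgrPdist_le/(_ _ e3)[N _ /(_ N (leqnn _)) AN] := cA.
have {}AN : limn (series A) - series A N <= e / 3 by apply: le_trans (ler_norm _) AN.
have cS : series (h ^~ y) N @[y --> t] --> series (h ^~ t) N.
  rewrite /series/=; elim: N {AN} => [|N IH].
    by under eq_fun do rewrite big_geq//; rewrite big_geq//; exact: cvg_cst.
  under eq_fun do rewrite big_nat_recr//=.
  by rewrite big_nat_recr//=; apply: cvgD => //; exact: ch.
have /cvgrPdist_le/(_ _ e3) := cS; apply: filterS2 hA => y hy Sy.
have T1 := dominated_series_tail N htA cA.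
have T2 := dominated_series_tail N hy cA.
rewrite (_ : _ - _ = (limn (series (h^~ t)) - series (h^~ t) N)
  + (series (h^~ t) N - series (h^~ y) N)
  - (limn (series (h^~ y)) - series (h^~ y) N)); last by ring.
rewrite (le_trans (ler_normB _ _))//.
have := ler_normD (limn (series (h^~ t)) - series (h^~ t) N)
  (series (h^~ t) N - series (h^~ y) N).
by move: Sy T1 T2 => /=; lra.
Qed.

Section integration.
Variables (D : set R) (h : nat -> R -> R) (A : R^nat).
Hypotheses (mD : measurable D) (Dfin : (mu D < +oo)%E).
Hypothesis mh : forall j, measurable_fun D (h j).
Hypothesis hA : forall j s, D s -> `|h j s| <= A j.
Hypothesis cA : cvgn (series A).

Lemma measurable_partial_sum n : measurable_fun D (fun s => series (h ^~ s) n).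
Proof. exact: measurable_sum. Qed.

Lemma measurable_limn_series : measurable_fun D (fun s => limn (series (h ^~ s))).
Proof.
apply: (measurable_fun_cvg (h := fun n s => series (h ^~ s) n)).
  exact: measurable_partial_sum.
by move=> s Ds; apply: dominated_series_cvg cA => j; exact: hA.
Qed.

Lemma integrable_bounded (k : R -> R) C : measurable_fun D k ->
  (forall s, D s -> `|k s| <= C) -> mu.-integrable D (EFin \o k).
Proof.
move=> mk kC; apply: measurable_bounded_integrable => //.
exists C; split; first exact: num_real.
by move=> C' CC' s Ds; apply: le_trans (kC s Ds) (ltW CC').
Qed.

Lemma integrable_limn_series :
  mu.-integrable D (EFin \o (fun s => limn (series (h ^~ s)))).
Proof.
apply: (@integrable_bounded _ (limn (series A))).
  exact: measurable_limn_series.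
move=> s Ds; have := @dominated_series_tail (h ^~ s) A 0 (fun j => hA j Ds) cA.
by rewrite /series/= !big_geq// !subr0.
Qed.

Lemma Rintegral_partial_sum n :
  series (fun j => \int[mu]_(s in D) h j s) n =
  \int[mu]_(s in D) series (h ^~ s) n.
Proof.
have ih j : mu.-integrable D (EFin \o h j) by apply: integrable_bounded (hA j).
rewrite /series/=; elim: n => [|n IH].
  rewrite big_geq//; under eq_Rintegral do rewrite big_geq//.
  by rewrite Rintegral_cst// mul0r.
rewrite big_nat_recr//= IH -RintegralD//.
  by apply: eq_Rintegral => s _; rewrite big_nat_recr.
apply: (@integrable_bounded _ (limn (series A))).
  exact: measurable_partial_sum.
by move=> s Ds; apply: dominated_series_le => // j; exact: hA.
Qed.

(** Dominated convergence: the partial sums are bounded by the sum of the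
majorant, a constant, on a set of finite measure. *)
Lemma integral_series_cvg :
  series (fun j => \int[mu]_(s in D) h j s) @ \oo
    --> \int[mu]_(s in D) limn (series (h ^~ s)).
Proof.
rewrite (_ : series _ = fun n => \int[mu]_(s in D) series (h ^~ s) n); last first.
  by apply/funext => n; exact: Rintegral_partial_sum.
have mS n : measurable_fun D (fun s => (series (h ^~ s) n)%:E).
  by apply/measurable_EFinP; exact: measurable_partial_sum.
have mL : measurable_fun D (fun s => (limn (series (h ^~ s)))%:E).
  by apply/measurable_EFinP; exact: measurable_limn_series.
have iA : mu.-integrable D (cst (limn (series A))%:E).
  apply: (@integrable_bounded (cst (limn (series A))) `|limn (series A)|) => //.
have ptw s : D s -> (series (h ^~ s) n)%:E @[n --> \oo]
    --> (limn (series (h ^~ s)))%:E.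
  move=> Ds; apply: cvg_EFin; first exact: nearW.
  by apply: dominated_series_cvg cA => j; exact: hA.
have dom s n : D s -> (`|(series (h ^~ s) n)%:E| <= (limn (series A))%:E)%E.
  by move=> Ds; rewrite lee_fin; apply: dominated_series_le => // j; exact: hA.
have [||_ _ H] := @dominated_convergence _ _ R mu D mD
  (fun n s => (series (h ^~ s) n)%:E) _ _ mS mL _ iA.
- by apply: aeW; exact: ptw.
- by apply: aeW; exact: dom.
apply: (@fine_cvg R nat eventually) => /=.
rewrite fineK//.
by apply: integrable_fin_num => //; exact: integrable_limn_series.
Qed.

End integration.
End series_of_functions.

(** * Expansion of the Mittag-Leffler convolution *)

Section mittag_leffler_kernel.
Context {R : realType}.
Notation mu := (@lebesgue_measure R).
Variable beta : R.
Hypothesis beta0 : 0 < beta.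

Lemma order_ge0 j : 0 <= beta * j%:R.
Proof. by rewrite mulr_ge0// ltW. Qed.

Lemma Gamma_order_gt0 j : 0 < Gamma (beta * j%:R + 1).
Proof. by rewrite Gamma_gt0// ltr_wpDl// order_ge0. Qed.

(** Choosing [M] with [M `^ beta = 2 * r + 1] in [Gamma_lower_bound] bounds the
terms by a geometric sequence of ratio [r / (2 * r + 1)]. *)
Lemma mittag_leffler_abs_cvg (r : R) : 0 <= r ->
  cvgn (series (fun j => r ^+ j / Gamma (beta * j%:R + 1))).
Proof.
move=> r0; pose M := (2 * r + 1) `^ beta^-1.
have q0 : 0 < 2 * r + 1 by lra.
have M0 : 0 < M by rewrite powR_gt0.
have MB : M `^ beta = 2 * r + 1.
  by rewrite -powRrM mulVf ?gt_eqF// powRr1// ltW.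
pose q := r / (2 * r + 1).
have q_ge0 : 0 <= q by rewrite divr_ge0// ltW.
apply: (@series_le_cvg _ _ (geometric (expR (M + 1)) q)) => [j|j|j|].
- by rewrite divr_ge0 ?exprn_ge0// ltW// Gamma_order_gt0.
- by rewrite /= mulr_ge0 ?expR_ge0// exprn_ge0.
- rewrite /= ler_pdivrMr ?Gamma_order_gt0//.
  have := Gamma_lower_bound M0 (order_ge0 j).
  rewrite powRrM MB (powR_mulrn _ (ltW q0)) expRN ler_pdivrMr ?expR_gt0// => H.
  rewrite expr_div_n; set e := expR _ in H *; set G := Gamma _ in H *.
  rewrite (_ : e * _ * G = r ^+ j * (G * e / (2 * r + 1) ^+ j)); last by ring.
  by rewrite ler_peMr ?exprn_ge0// ler_pdivlMr ?exprn_gt0// mul1r.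
- apply: is_cvg_geometric_series; rewrite ger0_norm//.
  by rewrite ltr_pdivrMr// mul1r; lra.
Qed.

Lemma mittag_leffler_cvg z :
  series (fun j => z ^+ j / Gamma (beta * j%:R + 1)) @ \oo
    --> mittag_leffler beta z.
Proof.
apply: (dominated_series_cvg _ (mittag_leffler_abs_cvg (normr_ge0 z))) => j.
by rewrite normrM normrX normfV [X in _ / X]ger0_norm// ltW// Gamma_order_gt0.
Qed.

Lemma measurable_mittag_leffler : measurable_fun [set: R] (mittag_leffler beta).
Proof.
apply: (@measurable_fun_cvg _ _ _ setT (fun n (z : R) =>
  series (fun j => z ^+ j / Gamma (beta * j%:R + 1)) n) (mittag_leffler beta)).
  by move=> n; apply: measurable_sum => j; apply: measurable_funM => //.
by move=> z _; exact: mittag_leffler_cvg.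
Qed.

Variables (g : R -> R) (M : R).
Hypothesis cg : continuous g.
Hypothesis gM : forall s, `|g s| <= M.
Variables (m a : R).

Definition expansion_term j t : R :=
  m ^+ j / Gamma (beta * j%:R + 1) * scaled_RL (beta * j%:R) a g t.

(** Dominates the terms of the expansion on every interval of length [L] starting
at [a]. *)
Let majorant L (j : nat) : R := M * ((`|m| * L `^ beta) ^+ j / Gamma (beta * j%:R + 1)).

Lemma cvg_majorant L : cvgn (series (majorant L)).
Proof.
have r0 : 0 <= `|m| * L `^ beta by rewrite mulr_ge0 ?powR_ge0.
have := @is_cvg_seriesZ _ _ M (mittag_leffler_abs_cvg r0).
by [].
Qed.

Lemma coeff_bound L y j : 0 <= y <= L ->
  `|m ^+ j / Gamma (beta * j%:R + 1)| * (M * y `^ (beta * j%:R)) <= majorant L j.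
Proof.
move=> /andP[y0 yL].
rewrite /majorant normrM normrX normfV [X in _ / X * _]ger0_norm; last first.
  by rewrite ltW// Gamma_order_gt0.
rewrite exprMn mulrCA ler_wpM2l ?(sup_bound_ge0 gM)// mulrAC.
rewrite ler_wpM2r ?invr_ge0 ?(ltW (Gamma_order_gt0 j))//.
rewrite ler_wpM2l ?exprn_ge0// powRrM powR_mulrn ?powR_ge0//.
rewrite lerXn2r ?nnegrE ?powR_ge0//.
by apply: ge0_ler_powR; rewrite ?nnegrE //; [exact: ltW|exact: le_trans yL].
Qed.

Lemma expansion_term_bound L j t : a <= t <= a + L ->
  `|expansion_term j t| <= majorant L j.
Proof.
move=> /andP[at0 tL]; apply: le_trans (@coeff_bound L (t - a) j _); last first.
  by apply/andP; split; lra.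
by rewrite normrM ler_wpM2l// (scaled_RL_bound cg gM)// order_ge0.
Qed.

Lemma expansion_term_continuous j t : a < t ->
  {for t, continuous (expansion_term j)}.
Proof.
move=> a_t; apply: cvgM; first exact: cvg_cst.
by apply: (scaled_RL_continuous cg gM) => //; exact: order_ge0.
Qed.

Lemma measurable_expansion_term j y : measurable_fun `[a, y] (expansion_term j).
Proof.
apply: measurable_funM => //.
by apply: (measurable_scaled_RL cg gM); exact: order_ge0.
Qed.

Definition expansion t : R := limn (series (expansion_term ^~ t)).

(** Both sides are the sum of the same series of integrals. Its terms agree by
[scaled_RL_primitive], and on each side the sum and the integral may be
exchanged. *)
Lemma mittag_leffler_primitive L y : a <= y <= a + L ->
  \int[mu]_(s in `[a, y]) (g s * mittag_leffler beta (m * (y - s) `^ beta)) =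
  \int[mu]_(t in `[a, y]) expansion t.
Proof.
move=> /andP[ay yL].
have Dfin : (mu `[a, y] < +oo)%E.
  by rewrite lebesgue_measure_itv/=; case: ifP => _; rewrite ?ltry// -EFinB ltry.
pose k j s := m ^+ j / Gamma (beta * j%:R + 1) * ((y - s) `^ (beta * j%:R) * g s).
have mpow j : measurable_fun `[a, y] (fun s => (y - s) `^ (beta * j%:R) * g s).
  apply: measurable_funM; last exact: continuous_measurable_funTS.
  apply: measurable_funTS.
  by apply: (measurableT_comp (@measurable_powR R _)); exact: measurable_funB.
have bpow j s : `[a, y]%classic s ->
    `|(y - s) `^ (beta * j%:R) * g s| <= M * (y - s) `^ (beta * j%:R).
  move=> _; rewrite normrM mulrC [X in _ * X]ger0_norm ?powR_ge0//.
  by rewrite ler_wpM2r ?powR_ge0.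
have mk j : measurable_fun `[a, y] (k j) by exact: measurable_funM.
have kA j s : `[a, y]%classic s -> `|k j s| <= majorant L j.
  move=> /[dup] sI /=; rewrite in_itv/= => /andP[as0 sy].
  apply: le_trans (@coeff_bound L (y - s) j _); last first.
    by apply/andP; split; lra.
  by rewrite normrM ler_wpM2l// bpow.
have hA j t : `[a, y]%classic t -> `|expansion_term j t| <= majorant L j.
  rewrite /= in_itv/= => /andP[a_t ty]; apply: expansion_term_bound.
  by rewrite a_t (le_trans ty).
have c1 := @integral_series_cvg _ `[a, y] k (majorant L)
  (measurable_itv _) Dfin mk kA (@cvg_majorant L).
have c2 := @integral_series_cvg _ `[a, y] expansion_term (majorant L)
  (measurable_itv _) Dfin (fun j => @measurable_expansion_term j y) hA (@cvg_majorant L).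
have kh j : \int[mu]_(s in `[a, y]) k j s =
    \int[mu]_(t in `[a, y]) expansion_term j t.
  rewrite RintegralZl//; last first.
    apply: (@integrable_bounded _ _ (measurable_itv _) Dfin _
      (M * L `^ (beta * j%:R))) => // s sI.
    rewrite (le_trans (bpow _ _ sI))// ler_wpM2l ?(sup_bound_ge0 gM)//.
    move: sI; rewrite /= in_itv/= => /andP[as0 sy].
    by apply: ge0_ler_powR; rewrite ?nnegrE ?order_ge0//; lra.
  rewrite RintegralZl//; last first.
    apply: (@integrable_bounded _ _ (measurable_itv _) Dfin _
      (M * L `^ (beta * j%:R))).
      by apply: (measurable_scaled_RL cg gM); exact: order_ge0.
    move=> t; rewrite /= in_itv/= => /andP[a_t ty].
    rewrite (le_trans (scaled_RL_bound cg gM (order_ge0 j) a_t))//.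
    rewrite ler_wpM2l ?(sup_bound_ge0 gM)//.
    by apply: ge0_ler_powR; rewrite ?nnegrE ?order_ge0//; lra.
  by congr (_ * _); rewrite (scaled_RL_primitive cg gM)// order_ge0.
have -> : \int[mu]_(t in `[a, y]) expansion t =
    \int[mu]_(s in `[a, y]) limn (series (k ^~ s)).
  rewrite -(cvg_lim _ c2)// -(cvg_lim _ c1)//.
  by congr (limn (series _)); apply/funext => j; rewrite kh.
apply: eq_Rintegral => s /set_mem/=; rewrite in_itv/= => /andP[as0 sy].
have := @lim_seriesZ _ _ (g s)
  (cvgP _ (@mittag_leffler_cvg (m * (y - s) `^ beta))).
move=> /esym H; apply: (etrans H).
congr (limn (series _)); apply/funext => j.
rewrite [LHS](_ : _ = g s *
  ((m * (y - s) `^ beta) ^+ j / Gamma (beta * j%:R + 1)))//.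
by rewrite /k powRrM powR_mulrn ?powR_ge0// exprMn; ring.
Qed.

(** The fundamental theorem of calculus: by [mittag_leffler_primitive] the function
is a primitive of [expansion], which is continuous at [x]. *)
Lemma expansion_derivative x : a < x ->
  is_derive x 1
    (fun y => \int[mu]_(s in `[a, y])
       (g s * mittag_leffler beta (m * (y - s) `^ beta))) (expansion x).
Proof.
move=> ax; pose L := x + 1 - a.
have aL : a + L = x + 1 by rewrite /L; ring.
have xx1 : x < x + 1 by lra.
have I : mu.-integrable `[a, x + 1] (EFin \o expansion).
  apply: (@integrable_limn_series _ _ _ (majorant L)) => //.
  - by rewrite lebesgue_measure_itv/=; case: ifP => _; rewrite ?ltry// -EFinB ltry.
  - by move=> j; exact: measurable_expansion_term.
  - by move=> j s /=; rewrite in_itv/= => H; apply: expansion_term_bound; rewrite aL.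
  - exact: cvg_majorant.
have C : {for x, continuous expansion}.
  apply: (@continuous_series _ _ (majorant L)).
  - by move=> j; exact: expansion_term_continuous.
  - near=> y => j; apply: expansion_term_bound; rewrite aL.
    have : y \in `]a, (x + 1)[.
      by near: y; apply: near_in_itvoo; rewrite in_itv/= ax.
    by rewrite in_itv/= => /andP[/ltW -> /ltW ->].
  - exact: cvg_majorant.
have [D E] := continuous_FTC1_closed xx1 I ax C.
apply: (@near_eq_is_derive _ _ _ (fun y => \int[mu]_(t in `[a, y]) expansion t)).
  near=> y; apply/esym/(@mittag_leffler_primitive L); rewrite aL.
  have : y \in `]a, (x + 1)[.
    by near: y; apply: near_in_itvoo; rewrite in_itv/= ax.
  by rewrite in_itv/= => /andP[/ltW -> /ltW ->].
by apply: DeriveDef => //; rewrite -E derive1E.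
Unshelve. all: by end_near. Qed.

Lemma cvg_expansion x : a <= x -> cvgn (series (expansion_term ^~ x)).
Proof.
move=> ax; apply: (dominated_series_cvg _ (@cvg_majorant (x - a))) => j.
by apply: expansion_term_bound; apply/andP; split; lra.
Qed.

End mittag_leffler_kernel.

(** * The left-sided formula *)

Section clamping.
Context {R : realType}.
Implicit Types (a b s : R) (G : R -> R).

(** Composing with this retraction turns a function continuous on [[a, b]] only into
a bounded continuous function on the line. *)
Definition clamp a b s : R := Num.min (Num.max s a) b.

Lemma clamp_itv a b s : a <= b -> a <= clamp a b s <= b.
Proof. by move=> ab; rewrite /clamp le_min le_max lexx orbT ab ge_min lexx orbT. Qed.

Lemma clamp_id a b s : a <= s <= b -> clamp a b s = s.
Proof. by move=> /andP[as0 sb]; rewrite /clamp max_l// min_l. Qed.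

Lemma continuous_clamp a b G : a <= b -> {within `[a, b], continuous G} ->
  continuous (G \o clamp a b).
Proof.
move=> ab /subspace_continuousP cG s.
have cc : {for s, continuous (clamp a b)}.
  apply: continuous_min; last exact: cvg_cst.
  by apply: continuous_max; [exact: cvg_id|exact: cvg_cst].
have sI : `[a, b]%classic (clamp a b s) by rewrite /= in_itv/= clamp_itv.
move=> U /(cG _ sI); rewrite !nbhs_simpl/= /within/= => H.
have := cc _ H; rewrite nbhs_simpl/=; apply: filterS => t; apply.
by rewrite in_itv/= clamp_itv.
Qed.

Lemma bounded_clamp a b G : a <= b -> {within `[a, b], continuous G} ->
  exists M, forall s, `|(G \o clamp a b) s| <= M.
Proof.
move=> ab cG.
have [|c _ cM] := @EVT_max _ (fun s => `|G s|) a b ab.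
  by move=> s; apply: cvg_norm; exact: cG.
by exists `|G c| => s; apply: cM; rewrite in_itv/= clamp_itv.
Qed.

End clamping.

Section left_formula.
Context {R : realType}.
Variables (alpha beta a b : R) (w f : R -> R).
Hypotheses (hab : a < b) (hbeta : 0 < beta).
Hypothesis hg : {within `[a, b], continuous (fun s => w s * f s)}.

Let g : R -> R := (fun s => w s * f s) \o clamp a b.

(** The factor [gam] of [scaled_RL] turns [Gamma gam] into [Gamma (gam + 1)]. *)
Lemma left_RL_integralE gam x : a <= x <= b -> 0 <= gam -> w x != 0 ->
  left_RL_integral gam a w f x =
  (w x)^-1 * ((Gamma (gam + 1))^-1 * scaled_RL gam a g x).
Proof.
move=> /andP[ax xb] gam0 wx0; rewrite /left_RL_integral.
have [M gM] := bounded_clamp (ltW hab) hg.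
have [->|gamN0] := eqVneq gam 0.
  rewrite add0r Gamma1 invr1 mul1r /scaled_RL eqxx /g /= clamp_id ?ax//.
  by rewrite mulKf.
have {gam0}gam0 : 0 < gam by rewrite lt_neqAle eq_sym gamN0.
rewrite mulrAC mulrC; congr (_ * _).
rewrite GammaD1// invfM -mulrA mulrCA; congr (_ * _).
rewrite /scaled_RL (negbTE gamN0) -RintegralZl//; last first.
  apply: (integrable_left_kernel_mul (continuous_clamp (ltW hab) hg) gM _ _ gam0).
apply: eq_Rintegral => s /set_mem/=; rewrite in_itv/= => /andP[as0 sx].
rewrite /g /= clamp_id ?as0 ?(le_trans sx)//.
by field.
Qed.

Lemma left_primitive_expansion x : a < x < b -> w x != 0 ->
  cvgn (series (left_term alpha beta a w f x)) /\
  is_derive x 1 (left_primitive alpha beta a w f)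
    (w x * limn (series (left_term alpha beta a w f x))).
Proof.
move=> /andP[ax xb] wx0.
have [M gM] := bounded_clamp (ltW hab) hg.
have cg := continuous_clamp (ltW hab) hg.
have tE : left_term alpha beta a w f x =
    (w x)^-1 *: (fun j => expansion_term beta g (- mu alpha) a j x).
  apply/funext => j.
  rewrite /left_term left_RL_integralE ?order_ge0 ?(ltW ax) ?(ltW xb)//.
  by rewrite mulrCA [X in _ * X]mulrA.
have cE := cvg_expansion hbeta cg gM (m := - mu alpha) (ltW ax).
split; first by rewrite tE; exact: is_cvg_seriesZ.
rewrite tE lim_seriesZ// [w x * _]mulrA.
rewrite mulfV// mul1r.
apply: near_eq_is_derive (expansion_derivative hbeta cg gM (- mu alpha) ax).
near=> y; have : y \in `]a, b[.
  by near: y; apply: near_in_itvoo; rewrite in_itv/= ax.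
rewrite in_itv/= => /andP[ay yb].
apply: eq_Rintegral => s /set_mem/=; rewrite in_itv/= => /andP[as0 sy].
by rewrite /g /= clamp_id// as0 (le_trans sy)// ltW.
Unshelve. all: by end_near. Qed.

End left_formula.

(** * Reflection and the right-sided formula *)

Section reflection.
Context {R : realType}.
Variables (a b : R) (w f : R -> R).
Hypotheses (hab : a < b).
Hypothesis hg : {within `[a, b], continuous (fun s => w s * f s)}.

Let w' s := w (- s).
Let f' s := f (- s).

Lemma continuous_reflected :
  {within `[- b, - a], continuous (fun s => w' s * f' s)}.
Proof.
move/subspace_continuousP : hg => cg; apply/subspace_continuousP => s sI.
have sI' : `[a, b]%classic (- s).
  by move: sI; rewrite /= !in_itv/= => /andP[? ?]; apply/andP; split; lra.
move=> U /(cg _ sI'); rewrite !nbhs_simpl/= /within/= => H.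
have cN : {for s, continuous (@GRing.opp R)} by exact: opp_continuous.
have := cN _ H; rewrite nbhs_simpl/=.
apply: filterS => t Ht tI; apply: Ht.
by move: tI; rewrite !in_itv/= => /andP[? ?]; apply/andP; split; lra.
Qed.

(** Clamping makes the integrand measurable on the whole line, as
[integral_reflect] requires, without changing it on [[y, b]]. *)
Lemma integral_reflected (k : R -> R) y : a <= y -> measurable_fun [set: R] k ->
  \int[lebesgue_measure]_(s in `[y, b]) (w s * f s * k (s - y)) =
  \int[lebesgue_measure]_(s in `[- b, - y]) (w' s * f' s * k (- y - s)).
Proof.
move=> ay mk.
pose g := (fun s => w s * f s) \o clamp a b.
have -> : \int[lebesgue_measure]_(s in `[y, b]) (w s * f s * k (s - y)) =
    \int[lebesgue_measure]_(s in `[y, b]) (g s * k (s - y)).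
  apply: eq_Rintegral => s /set_mem/=; rewrite in_itv/= => /andP[ys sb].
  by rewrite /g /= clamp_id// sb (le_trans ay).
congr fine; rewrite (@integral_reflect _ _ 0)/=; last first.
  apply/measurable_EFinP; apply: measurable_funM.
    by apply: continuous_measurable_fun; exact: (continuous_clamp (ltW hab) hg).
  by apply: (measurableT_comp mk); exact: measurable_funB.
rewrite !sub0r; apply: eq_integral => s /set_mem/=; rewrite in_itv/= => /andP[bs sy].
rewrite sub0r /g /w' /f' /= clamp_id; last by apply/andP; split; lra.
by rewrite [- s - y]addrC.
Qed.

Lemma right_RL_integralE gam x : a <= x ->
  right_RL_integral gam b w f x = left_RL_integral gam (- b) w' f' (- x).
Proof.
move=> ax; rewrite /right_RL_integral /left_RL_integral.
case: ifP => _; first by rewrite /f' opprK.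
rewrite {1}/w' opprK; congr (_ * _).
transitivity (\int[lebesgue_measure]_(s in `[x, b])
    (w s * f s * (s - x) `^ (gam - 1))).
  by apply: eq_Rintegral => s _; ring.
rewrite (integral_reflected (k := fun u => u `^ (gam - 1)) ax)//.
by apply: eq_Rintegral => s _; ring.
Qed.

Lemma right_termE alpha beta x : a <= x ->
  right_term alpha beta b w f x = left_term alpha beta (- b) w' f' (- x).
Proof.
move=> ax; apply/funext => j.
by rewrite /right_term /left_term right_RL_integralE.
Qed.

Lemma right_primitiveE alpha beta x : 0 < beta -> a <= x ->
  right_primitive alpha beta b w f x = left_primitive alpha beta (- b) w' f' (- x).
Proof.
move=> b0 ax; rewrite /right_primitive /left_primitive.
rewrite (integral_reflected (k := fun u =>
  mittag_leffler beta (- mu alpha * u `^ beta)) ax)//.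
apply: (measurableT_comp (measurable_mittag_leffler b0)).
by apply: measurable_funM => //; exact: measurable_powR.
Qed.

(** The right operators of [w] and [f] are the left ones of the functions reflected
at the origin; the chain rule for [y |-> - y] produces the sign. *)
Lemma right_primitive_expansion alpha beta x : 0 < beta -> a < x < b -> w x != 0 ->
  cvgn (series (right_term alpha beta b w f x)) /\
  is_derive x 1 (right_primitive alpha beta b w f)
    (- (w x * limn (series (right_term alpha beta b w f x)))).
Proof.
move=> b0 /andP[ax xb] wx0.
have hab' : - b < - a by rewrite ltrN2.
have xI : - b < - x < - a by rewrite !ltrN2 ax xb.
have wx0' : w' (- x) != 0 by rewrite /w' opprK.
have [c d] := left_primitive_expansion alpha hab' b0 continuous_reflected xI wx0'.
rewrite right_termE ?ltW//; split => //.
have dN : is_derive x 1 (-%R : R -> R) (-1) by apply: is_derive_eq.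
have := is_derive1_comp d dN.
have -> : w' (- x) = w x by rewrite /w' opprK.
rewrite mulrN1; apply: near_eq_is_derive.
near=> y; rewrite /= right_primitiveE//.
by apply: ltW; near: y; exact: lt_nbhsr.
Unshelve. all: by end_near. Qed.

End reflection.

(** Near [x], [w y] is the difference quotient times [y - x], plus [w x]. *)
Lemma C1_continuous (R : realType) (a b : R) (w dw : R -> R) :
  C1_with_derivative a b w dw -> {within `[a, b], continuous w}.
Proof.
move=> [_ dwP]; apply/subspace_continuousP => x xab.
have xI : a <= x <= b by move: xab; rewrite /= in_itv.
have idx : (y - x) @[y --> within `[a, b] x^'] --> (0 : R).
  rewrite -(subrr x); apply: cvgB; last exact: cvg_cst.
  by apply: cvg_within_filter; exact: cvg_within.
have H : (w y - w x) / (y - x) * (y - x) + w x @[y --> within `[a, b] x^']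
    --> w x.
  rewrite -[X in _ --> X]add0r -[X in _ --> X + _](mulr0 (dw x)).
  by apply: cvgD; [exact: cvgM (dwP x xI) idx|exact: cvg_cst].
move=> U Uwx.
(* the punctured neighbourhood filter, unfolded: only y = x is missing *)
have K : nbhs x (fun y => y != x -> `[a, b]%classic y ->
    U ((w y - w x) / (y - x) * (y - x) + w x)) := H U Uwx.
rewrite !nbhs_simpl/= /within/=; apply: filterS K => y Hy yab.
have [->|yx] := eqVneq y x; first exact: nbhs_singleton Uwx.
by have := Hy yx yab; rewrite /= mulfVK ?subr_eq0// subrK.
Qed.

Unset Implicit Arguments.

Theorem theorem1 (R : realType) (B : R -> R) (a b alpha beta : R)
    (w dw f : R -> R)
    (hB0 : B 0 = 1) (hB1 : B 1 = 1) (hBalpha : B alpha != 0)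
    (hab : a < b) (halpha0 : 0 <= alpha) (halpha1 : alpha < 1)
    (hbeta : 0 < beta)
    (hw : C1_with_derivative a b w dw)
    (hw_pos : forall x, a <= x <= b -> 0 < w x)
    (hdw_pos : forall x, a <= x <= b -> 0 < dw x)
    (hf : H1 a b f) (x : R) (hx : a < x < b) :
  [/\ derivable (left_primitive alpha beta a w f) x 1,
      cvgn (series (left_term alpha beta a w f x))
    & left_derivative B alpha beta a w f x =
      (phi B alpha)^-1 * limn (series (left_term alpha beta a w f x))] /\
  [/\ derivable (right_primitive alpha beta b w f) x 1,
      cvgn (series (right_term alpha beta b w f x))
    & right_derivative B alpha beta b w f x =
      (phi B alpha)^-1 * limn (series (right_term alpha beta b w f x))].
Proof.
have [_ _ cf] := hf.
have hg : {within `[a, b], continuous (fun s => w s * f s)}.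
  by move=> s; apply: cvgM; [exact: (C1_continuous hw)|exact: cf].
have wx0 : w x != 0.
  by have /andP[ax xb] := hx; rewrite gt_eqF// hw_pos// !ltW.
have [cl dL] := left_primitive_expansion alpha hab hbeta hg hx wx0.
have [cr dR] := right_primitive_expansion hab hg alpha hbeta hx wx0.
have dl := @ex_derive _ _ _ _ _ _ _ dL.
have dlE := @derive_val _ _ _ _ _ _ _ dL.
have dr := @ex_derive _ _ _ _ _ _ _ dR.
have drE := @derive_val _ _ _ _ _ _ _ dR.
split; split; [exact: dl|exact: cl| |exact: dr|exact: cr|].
- by rewrite /left_derivative derive1E dlE -mulrA mulKf.
- rewrite /right_derivative derive1E drE.
  by move: (phi B alpha) (limn _) => p l; rewrite -mulrA mulrN mulKf// mulrNN.
Qed.
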